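(* Fix $\alpha>0$ and let $H=H(n,\alpha)$ be a minimum-size hitting set of the random set system $R(n,p)$ with $p=n^{\alpha}/2^{n}$ (for $n$ large enough that $p\le1$); write $|H|$ for its size. Then there is a real sequence $o_n$ with $o_n\to0$ as $n\to\infty$ such that, with probability tending to $1$ as $n\to\infty$, $|H|=h$ or $|H|=h+1$, where $$h=\big\lfloor\alpha\lg n-\lg(\alpha\lg n\,\ln n)-o_n\big\rfloor+1.$$
   Context: $[n]=\{1,2,\dots,n\}$, $\mathcal{P}([n])$ is its power set, $\lg=\log_2$, and $\ln$ is the natural logarithm. The random set system $R(n,p)$ is the random family $\mathcal{A}\subseteq\mathcal{P}([n])$ obtained by including each $A\in\mathcal{P}([n])$ independently with probability $p=p_n$. A set $S\subseteq[n]$ is a hitting set for $\mathcal{A}$ if $|A\cap S|\ge1$ for every $A\in\mathcal{A}$. $|H|$ is the minimum cardinality of a hitting set of $\mathcal{A}$; the event $|H|=k$ means that a hitting set of size $k$ exists and none of smaller size exists (if $\emptyset\in\mathcal A$ there is no hitting set and no such event occurs). *)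

(* Defs.v *)
(* MathComp world (MathComp-Analysis for the limits, ln and real powers). *)
From mathcomp Require Import all_boot all_order all_algebra.
From mathcomp Require Import all_classical all_reals all_analysis.

Set Implicit Arguments.
Unset Strict Implicit.
Unset Printing Implicit Defensive.

Import Order.TTheory GRing.Theory Num.Theory.
Import numFieldNormedType.Exports.

Local Open Scope ring_scope.

(* The ground set {1, ..., n} is represented by 'I_n = {0, ..., n - 1}. *)
Definition hitting_set (n : nat) (F : {set {set 'I_n}}) (S : {set 'I_n}) : bool :=
  [forall A in F, (1 <= #|A :&: S|)%N].

(* The event |H| = k, with k an integer since it is compared to a floor; it
   holds for no k when F contains the empty set. *)
Definition min_hitting_size_eq (n : nat) (F : {set {set 'I_n}}) (k : int) : bool :=
  [exists S : {set 'I_n}, hitting_set F S && (#|S|%:Z == k)]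
  && [forall S : {set 'I_n}, (#|S|%:Z < k) ==> ~~ hitting_set F S].

(* The law of R(n, p): each A is in F with probability p, independently, so F
   has a product of Bernoulli weights. This is a probability distribution
   exactly when 0 <= p <= 1. *)
Definition random_set_system_pmf (R : realType) (n : nat) (p : R)
    (F : {set {set 'I_n}}) : R :=
  \prod_(A : {set 'I_n}) (if A \in F then p else 1 - p).

Definition random_set_system_prob (R : realType) (n : nat) (p : R)
    (E : pred {set {set 'I_n}}) : R :=
  \sum_(F : {set {set 'I_n}} | E F) random_set_system_pmf p F.

Definition lg (R : realType) (x : R) : R := ln x / ln 2.

(* This exceeds 1 only for finitely many n, which do not affect limits. *)
Definition inclusion_prob (R : realType) (alpha : R) (n : nat) : R :=
  n%:R `^ alpha / 2 ^+ n.

Definition hitting_threshold (R : realType) (alpha : R) (o : nat -> R) (n : nat) : int :=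
  Num.floor (alpha * lg n%:R - lg (alpha * lg n%:R * ln n%:R) - o n) + 1.

(* Main.v *)
Require Import Defs.
From mathcomp Require Import all_boot all_order all_algebra.
From mathcomp Require Import all_classical all_reals all_analysis.
From mathcomp Require Import ring lra zify.

(* A fixed k-set hits the random system with probability (1-p)^(2^(n-k)), which is about
   exp(-n^alpha 2^(-k)). Let x = alpha lg n - lg (alpha lg n ln n) and k = floor x. The
   expected number of hitting sets of size k is at most exp(k ln n - n^alpha 2^(-k)), which
   tends to 0. For k = floor x + 2 the exponent n^alpha 2^(-k) is at most half of
   alpha lg n ln n, so there are many hitting sets on average, and the second moment method
   gives existence. It is applied only to the k-sets that have one point in each of k disjoint
   blocks of size m: they are indexed by functions f, two of them share as many points as the
   functions have agreements, and the sum over g of c^agree(f,g) is exactly (m - 1 + c)^k.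
   So o_n = 0 works. *)

Import Order.TTheory GRing.Theory Num.Theory.
Import numFieldNormedType.Exports.

Local Open Scope ring_scope.

(** * Hitting events under the product law *)

(** This form makes hitting the avoidance of a fixed family of sets, so single and joint hitting
    probabilities become powers of [1 - p]. *)
Lemma hitting_setE n (F : {set {set 'I_n}}) (S : {set 'I_n}) :
  hitting_set F S = [disjoint F & powerset (~: S)].
Proof.
rewrite disjoint_subset; apply/'forall_implyP/fintype.subsetP => H A AF.
  rewrite inE /= inE -finset.disjoints_subset -finset.setI_eq0.
  by have := H _ AF; rewrite card_gt0.
rewrite card_gt0 finset.setI_eq0 finset.disjoints_subset; apply/negP => AS.
by have := H A AF; rewrite inE /= inE AS.
Qed.

Lemma hitting_setS {n} {F : {set {set 'I_n}}} {S T : {set 'I_n}} :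
  S \subset T -> hitting_set F S -> hitting_set F T.
Proof.
move=> ST /'forall_implyP H; apply/'forall_implyP => A /H /leq_trans; apply.
exact: subset_leq_card (finset.setIS A ST).
Qed.

Lemma random_set_system_pmf_ge0 {R : realType} {n} {p : R} (F : {set {set 'I_n}}) :
  0 <= p <= 1 -> 0 <= random_set_system_pmf p F.
Proof.
by case/andP=> p0 p1; apply: prodr_ge0 => A _; case: ifP; rewrite ?subr_ge0.
Qed.

Lemma random_set_system_prob_disjoint {R : realType} {n} (p : R) (B : {set {set 'I_n}}) :
  random_set_system_prob p [pred F : {set {set 'I_n}} | [disjoint F & B]] = (1 - p) ^+ #|B|.
Proof.
(* Each factor is an inclusion weight plus an exclusion weight, with inclusion weight 0 on [B];
   outside [B] the two add up to 1. Distributing the product gives a sum over all [F], in which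
   those meeting [B] vanish. *)
have -> : (1 - p) ^+ #|B| = \prod_(A : {set 'I_n}) ((if A \in B then 0 else p) + (1 - p)).
  rewrite (bigID (mem B)) /= [X in _ * X]big1 ?mulr1 => [|A /negPf->]; last by rewrite addrC subrK.
  by rewrite (eq_bigr (fun=> 1 - p)) ?prodr_const // => A ->; rewrite add0r.
rewrite bigA_distr [RHS](bigID (fun F : {set {set 'I_n}} => [disjoint F & B])) /=.
rewrite [X in _ = _ + X]big1 ?addr0 => [|F /pred0Pn[A /andP[/= AF AB]]].
  apply: eq_big => //= F dFB; apply: eq_bigr => A _.
  by case: ifP => // AF; rewrite (disjointFr dFB AF).
by rewrite (bigD1 A) //= AF AB mul0r.
Qed.

Lemma card_powerset_setC {n} (S : {set 'I_n}) : #|powerset (~: S)| = (2 ^ (n - #|S|))%N.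
Proof.
have := cardsC S; rewrite card_powerset card_ord => e.
by congr (2 ^ _)%N; lia.
Qed.

Lemma random_set_system_prob_hitting {R : realType} {n} (p : R) (S : {set 'I_n}) :
  random_set_system_prob p [pred F | hitting_set F S] = (1 - p) ^+ (2 ^ (n - #|S|)).
Proof.
rewrite -card_powerset_setC -random_set_system_prob_disjoint.
by apply: eq_bigl => F /=; exact: hitting_setE.
Qed.

(** The two power sets to be avoided intersect in the power set of the complement of [S :|: T];
    inclusion-exclusion counts their union. *)
Lemma random_set_system_prob_hitting2 {R : realType} {n} (p : R) (S T : {set 'I_n}) :
  random_set_system_prob p [pred F | hitting_set F S && hitting_set F T] =
  (1 - p) ^+ (2 ^ (n - #|S|) + 2 ^ (n - #|T|) - 2 ^ (n - #|S :|: T|)).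
Proof.
rewrite -!card_powerset_setC finset.setCU powersetI -cardsU.
rewrite -random_set_system_prob_disjoint; apply: eq_bigl => F /=.
rewrite !hitting_setE !(disjoint_sym F) -disjointU.
by apply: eq_disjoint => A; apply/esym/finset.in_setU.
Qed.

Lemma random_set_system_prob_predT {R : realType} {n} (p : R) :
  random_set_system_prob p (@predT {set {set 'I_n}}) = 1.
Proof.
transitivity ((1 - p) ^+ #|@finset.set0 {set 'I_n}|); last by rewrite cards0 expr0.
rewrite -random_set_system_prob_disjoint; apply: eq_bigl => F.
by rewrite /= disjoint_sym finset.disjoints_subset finset.sub0set.
Qed.

Lemma random_set_system_prob_mono {R : realType} {n} (p : R) (E E' : pred {set {set 'I_n}}) :
  0 <= p <= 1 -> (forall F, E F -> E' F) ->
  random_set_system_prob p E <= random_set_system_prob p E'.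
Proof.
move=> p01 EE'; rewrite /random_set_system_prob [leLHS]big_mkcond [leRHS]big_mkcond.
apply: ler_sum => F _.
have := random_set_system_pmf_ge0 F p01.
by case: ifP => [/EE'->|_] //; case: ifP.
Qed.

Lemma random_set_system_prob_le1 {R : realType} {n} (p : R) (E : pred {set {set 'I_n}}) :
  0 <= p <= 1 -> random_set_system_prob p E <= 1.
Proof.
move=> p01; rewrite -(@random_set_system_prob_predT R n p).
exact: random_set_system_prob_mono.
Qed.

Lemma random_set_system_prob_compl {R : realType} {n} (p : R) (E : pred {set {set 'I_n}}) :
  random_set_system_prob p E = 1 - random_set_system_prob p (predC E).
Proof.
rewrite -(@random_set_system_prob_predT R n p) /random_set_system_prob.
by rewrite [X in _ = X - _](bigID E) /= addrK.
Qed.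

Lemma random_set_system_prob_union {R : realType} {n} (p : R) (I : finType)
    (E : pred {set {set 'I_n}}) (P : I -> pred {set {set 'I_n}}) :
  0 <= p <= 1 -> (forall F, E F -> [exists i, P i F]) ->
  random_set_system_prob p E <= \sum_i random_set_system_prob p (P i).
Proof.
move=> p01 EP; under [leRHS]eq_bigr do rewrite /random_set_system_prob big_mkcond.
rewrite exchange_big /= [leLHS]big_mkcond; apply: ler_sum => F _.
have w0 := random_set_system_pmf_ge0 F p01.
case: ifP => [/EP/existsP[i Pi]|_]; last by apply: sumr_ge0 => i _; case: ifP.
rewrite (bigD1 i) //= Pi lerDl; apply: sumr_ge0 => j _; by case: ifP.
Qed.

(** * First moment bound *)

(** Union bound over images of functions from ['I_k] to ['I_n]: every set of at most k points lies
    in such an image, and supersets of hitting sets hit. One bound thus covers all sizes up to k. *)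
Lemma random_set_system_prob_hitting_small {R : realType} {n} (p : R) (k : nat) :
  0 <= p <= 1 -> (0 < n)%N ->
  random_set_system_prob p
    [pred F : {set {set 'I_n}} | [exists S : {set 'I_n}, (#|S| <= k)%N && hitting_set F S]]
  <= n%:R ^+ k * (1 - p) ^+ (2 ^ (n - k)).
Proof.
move=> p01 n0; have [p0 p1] := andP p01.
pose T (f : {ffun 'I_k -> 'I_n}) := [set f i | i : 'I_k].
apply: (le_trans (@random_set_system_prob_union R n p {ffun 'I_k -> 'I_n} _
  (fun f => [pred F | hitting_set F (T f)]) p01 _)).
  move=> F /existsP[S /andP[Sk hS]]; apply/existsP.
  (* The enumeration of [S], padded with the point 0 when [S] has fewer than k elements. *)
  exists [ffun i : 'I_k => nth (Ordinal n0) (enum S) i] => /=.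
  apply: hitting_setS hS; apply/fintype.subsetP => x xS; apply/imsetP.
  have xk : (index x (enum S) < k)%N.
    by apply: leq_trans Sk; rewrite cardE index_mem mem_enum.
  by exists (Ordinal xk) => //; rewrite ffunE /= nth_index // mem_enum.
have -> : n%:R ^+ k = \sum_(f : {ffun 'I_k -> 'I_n}) (1 : R).
  by rewrite sumr_const card_ffun !card_ord natrX.
rewrite mulr_suml; apply: ler_sum => f _; rewrite mul1r.
rewrite (random_set_system_prob_hitting p (T f)).
apply: ler_wiXn2l; rewrite ?subr_ge0 ?gerBl //.
rewrite leq_exp2l // leq_sub2l //.
by apply: leq_trans (leq_imset_card _ _) _; rewrite card_ord.
Qed.

(** * Second moment bound over transversals *)

(** Chebyshev's inequality for the number [X] of events that occur: where none occurs, the squared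
    deviation from the mean is [e ^+ 2], and the right-hand side is the variance of [X]. *)
Lemma random_set_system_second_moment {R : realType} {n} (p : R) (I : finType)
    (P : I -> pred {set {set 'I_n}}) (e := \sum_i random_set_system_prob p (P i)) :
  0 <= p <= 1 ->
  e ^+ 2 * random_set_system_prob p [pred F | ~~ [exists i, P i F]] <=
  \sum_i \sum_j random_set_system_prob p [pred F | P i F && P j F] - e ^+ 2.
Proof.
move=> p01.
pose w (F : {set {set 'I_n}}) : R := random_set_system_pmf p F.
pose X F : R := \sum_i (P i F)%:R.
have prE (E : pred {set {set 'I_n}}) : random_set_system_prob p E = \sum_F w F * (E F)%:R.
  rewrite /random_set_system_prob big_mkcond; apply: eq_bigr => F _.
  by case: (E F); rewrite ?mulr1 ?mulr0.
have EX : \sum_F w F * X F = e.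
  rewrite /e; under [RHS]eq_bigr do rewrite prE.
  by rewrite exchange_big; apply: eq_bigr => F _; rewrite mulr_sumr.
have EX2 : \sum_F w F * X F ^+ 2 =
    \sum_i \sum_j random_set_system_prob p [pred F | P i F && P j F].
  under [RHS]eq_bigr => i _ do under eq_bigr do rewrite prE.
  under [RHS]eq_bigr => i _ do rewrite exchange_big.
  rewrite exchange_big; apply: eq_bigr => F _.
  rewrite expr2 mulr_suml mulr_sumr; apply: eq_bigr => i _.
  rewrite !mulr_sumr; apply: eq_bigr => j _.
  by rewrite /= -mulnb natrM.
have w1 : \sum_F w F = 1 by exact: random_set_system_prob_predT.
have -> : \sum_i \sum_j random_set_system_prob p [pred F | P i F && P j F] - e ^+ 2
    = \sum_F w F * (X F - e) ^+ 2.
  rewrite -EX2; transitivity (\sum_F (w F * X F ^+ 2 - w F * X F * (2 * e) + w F * e ^+ 2)).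
    by rewrite big_split sumrB /= -!mulr_suml EX w1; ring.
  by apply: eq_bigr => F _; ring.
rewrite prE mulr_sumr; apply: ler_sum => F _ /=.
have w0 : 0 <= w F by exact: random_set_system_pmf_ge0.
case: existsP => [_|noP] /=; first by rewrite !mulr0 mulr_ge0 // sqr_ge0.
have -> : X F = 0 by apply: big1 => i _; case PF: (P i F) => //; case: noP; exists i.
by rewrite sub0r sqrrN mulr1 mulrC.
Qed.

(** The sum factors over the points of ['I_k]: of the m values available at [a], one agrees with
    [f a] and contributes [c], the others contribute 1 each. *)
Lemma sum_expr_agree {R : comNzRingType} {k m : nat} (f : {ffun 'I_k -> 'I_m}) (c : R) :
  \sum_(g : {ffun 'I_k -> 'I_m}) c ^+ #|[set a | f a == g a]| = (m%:R - 1 + c) ^+ k.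
Proof.
have -> : (m%:R - 1 + c) ^+ k = \prod_(a < k) \sum_(b < m) (if f a == b then c else 1).
  rewrite -[k in LHS]card_ord -prodr_const; apply: eq_bigr => a _.
  rewrite (bigD1 (f a)) //= eqxx addrC; congr (_ + _).
  rewrite (eq_bigr (fun=> 1)) => [|b /negPf]; last by rewrite eq_sym => ->.
  by rewrite sumr_const cardC1 card_ord -subn1 natrB // (leq_trans _ (ltn_ord (f a))).
rewrite bigA_distr_bigA; apply: eq_bigr => g _ /=.
by rewrite -big_mkcond prodr_const cardsE.
Qed.

(** Convexity puts [2 ^ a] below its chord from 0 to k, relaxed here from slope [(2 ^ k - 1) / k] to
    [2 ^ k / k]. This makes the overlap exponent linear in the number of agreements, as
    [sum_expr_agree] requires. *)
Lemma pow2_chord (a k : nat) : (a <= k)%N -> (k * 2 ^ a <= k + a * 2 ^ k)%N.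
Proof.
move=> ak.
have : (k * (2 ^ a - 1) <= a * (2 ^ k - 1))%N.
  elim: k ak => [|k IH]; first by case: a.
  rewrite leq_eqVlt => /predU1P[->//|ak]; have {}IH := IH ak.
  have : (2 ^ a <= 2 ^ k)%N by rewrite leq_exp2l.
  rewrite expnS; case: a ak IH => [|a] ak IH h; first by rewrite !muln0.
  nia.
have [x ->] : exists x, (2 ^ a = x.+1)%N by exists (2 ^ a).-1%N; rewrite prednK ?expn_gt0.
have [y ->] : exists y, (2 ^ k = y.+1)%N by exists (2 ^ k).-1%N; rewrite prednK ?expn_gt0.
by rewrite !subn1 /= !mulnS; lia.
Qed.

(* S f has one point in each of k disjoint blocks of m points, chosen by f. *)
Lemma exists_transversals {n k m : nat} : (k * m <= n)%N ->
  exists S : {ffun 'I_k -> 'I_m} -> {set 'I_n},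
    (forall f, #|S f| = k) /\
    (forall f g, #|S f :|: S g| + #|[set a | f a == g a]| = 2 * k)%N.
Proof.
move=> kmn.
have kmE : #|{: 'I_k * 'I_m}| = (k * m)%N by rewrite card_prod !card_ord.
pose e (x : 'I_k * 'I_m) : 'I_n := widen_ord kmn (cast_ord kmE (enum_rank x)).
have e_inj : injective e.
  by move=> x y /(congr1 val) /= /ord_inj; apply: enum_rank_inj.
have ef_inj (f : {ffun 'I_k -> 'I_m}) : injective (fun a => e (a, f a)) by move=> a b /e_inj[].
exists (fun f => [set e (a, f a) | a : 'I_k]%SET).
have cardS (f : {ffun 'I_k -> 'I_m}) : #|[set e (a, f a) | a : 'I_k]%SET| = k.
  by rewrite (card_imset _ (ef_inj f)) card_ord.
split=> // f g.
(* As [e] is injective on pairs, a common point of two transversals comes from the same block and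
   the same choice there. *)
have -> : #|[set a | f a == g a]| =
    #|[set e (a, f a) | a : 'I_k]%SET :&: [set e (a, g a) | a : 'I_k]%SET|.
  rewrite -(card_imset _ (ef_inj f)); apply: eq_card => x; rewrite finset.in_setI.
  apply/imsetP/andP => [[a + ->]|[/imsetP[a _ ->] /imsetP[b _ /e_inj[<- E]]]].
    rewrite inE => /eqP E; split; apply/imsetP; exists a => //; by rewrite E.
  by exists a; rewrite // inE E.
by rewrite cardsUI !cardS mul2n addnn.
Qed.

(** A fixed k-set hits with probability [expR (- mu)]. Relative to the squared mean, the second
    moment over transversals is at most [expR (mu / 2 ^+ k) * ((m - 1 + c) / m) ^+ k] with
    [c = expR (mu / k)], and [1 + c / m <= expR (c / m)] finishes. *)
Lemma random_set_system_prob_no_hitting {R : realType} {n} (p : R) (k m : nat)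
    (mu := - ln (1 - p) * 2 ^+ (n - k)) :
  0 <= p < 1 -> (0 < k)%N -> (0 < m)%N -> (k * m <= n)%N ->
  random_set_system_prob p
    [pred F : {set {set 'I_n}} | ~~ [exists S : {set 'I_n}, (#|S| == k) && hitting_set F S]]
  <= expR (mu / 2 ^+ k + k%:R * expR (mu / k%:R) / m%:R) - 1.
Proof.
move=> /andP[p0 p1] k0 m0 kmn; have p01 : 0 <= p <= 1 by rewrite p0 ltW.
have [S [cardS cardSU]] := exists_transversals kmn.
set nu := - ln (1 - p) in mu *.
have q0 : 0 < 1 - p by rewrite subr_gt0.
have qE c : (1 - p) ^+ c = expR (- nu * c%:R) by rewrite opprK expRM_natr lnK.
have nu0 : 0 <= nu by rewrite oppr_ge0 ln_le0 // gerBl.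
have M0 : 0 < (2 : R) ^+ (n - k) by rewrite exprn_gt0.
pose P (f : {ffun 'I_k -> 'I_m}) := [pred F | hitting_set F (S f)].
have := @random_set_system_second_moment R n p {ffun 'I_k -> 'I_m} P p01.
set e := (X in X ^+ 2 * _); set N' := random_set_system_prob p _ => second_moment.
have eE : e = m%:R ^+ k * (1 - p) ^+ (2 ^ (n - k)).
  rewrite /e (eq_bigr (fun=> (1 - p) ^+ (2 ^ (n - k)))) => [|f _].
    by rewrite sumr_const card_ffun !card_ord -natrX mulr_natl.
  have := random_set_system_prob_hitting p (S f); rewrite cardS. by [].
have e0 : 0 < e by rewrite eE mulr_gt0 ?exprn_gt0 // ltr0n.
have pair f g : random_set_system_prob p [pred F | P f F && P g F] <=
    (1 - p) ^+ (2 ^ (n - k)) ^+ 2 * expR (mu / 2 ^+ k)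
    * expR (mu / k%:R) ^+ #|[set a | f a == g a]|.
  have -> : random_set_system_prob p [pred F | P f F && P g F] =
      (1 - p) ^+ (2 ^ (n - k) + 2 ^ (n - k) - 2 ^ (n - #|S f :|: S g|)).
    by have := random_set_system_prob_hitting2 p (S f) (S g); rewrite !cardS.
  have := cardSU f g; have : (#|[set a | f a == g a]| <= k)%N.
    by apply: leq_trans (max_card _) _; rewrite card_ord.
  have : (#|S f :|: S g| <= n)%N by apply: leq_trans (max_card _) _; rewrite card_ord.
  move: #|[set a | _]| #|_ :|: _| => a u un ak ua.
  (* Two transversals with [a] agreements have a union of size [u = 2 * k - a], so the correlation
     term [2 ^ (n - u)] is [2 ^ (n - k)] times [2 ^ a / 2 ^ k]. *)
  have DM : (2 ^ (n - u) * 2 ^ k = 2 ^ (n - k) * 2 ^ a)%N.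
    by rewrite -!expnD; congr (2 ^ _)%N; lia.
  have DE : (2 ^ (n - u))%:R = 2 ^+ (n - k) * 2 ^+ a / 2 ^+ k :> R.
    by rewrite -!natrX -natrM -DM natrM mulfK // pnatr_eq0 expn_eq0.
  have Dle : (2 ^ (n - u))%:R <= 2 ^+ (n - k) * (1 / 2 ^+ k + a%:R / k%:R) :> R.
    have kR : 0 < k%:R :> R by rewrite ltr0n.
    have tk : 0 < 2 ^+ k :> R by rewrite exprn_gt0.
    rewrite DE -mulrA ler_pM2l // addf_div ?gt_eqF // ler_pdivlMr ?mulr_gt0 //.
    rewrite mulrA divfK ?gt_eqF // mul1r mulrC -!natrX -!natrM -natrD ler_nat.
    exact: pow2_chord.
  rewrite -exprM !qE -expRM_natl -!expRD ler_expR natrB; last first.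
    by rewrite (leq_trans _ (leq_addr _ _)) // leq_exp2l //; lia.
  rewrite muln2 -addnn natrD.
  have := ler_wpM2l nu0 Dle; rewrite /mu natrX => {}Dle.
  lra.
have second_moment' : e ^+ 2 * N' <=
    e ^+ 2 * (expR (mu / 2 ^+ k) * ((m%:R - 1 + expR (mu / k%:R)) / m%:R) ^+ k - 1).
  apply: le_trans second_moment _; rewrite mulrBr mulr1 lerD2r.
  apply: le_trans (ler_sum _ (fun f _ => ler_sum _ (fun g _ => pair f g))) _.
  under eq_bigr do rewrite -mulr_sumr sum_expr_agree.
  rewrite sumr_const card_ffun !card_ord -[leLHS]mulr_natl natrX eE expr_div_n.
  rewrite le_eqVlt; apply/orP; left; apply/eqP; field.
  by rewrite expf_neq0 // pnatr_eq0 -lt0n.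
set N := random_set_system_prob p _; have : N <= N'.
  apply: random_set_system_prob_mono => // F /=; apply: contraNN => /existsP[f hf].
  by apply/existsP; exists (S f); rewrite cardS eqxx.
move: second_moment'; rewrite ler_pM2l ?exprn_gt0 // => N'le /le_trans; apply.
apply: (le_trans N'le); rewrite lerD2r expRD ler_wpM2l ?expR_ge0 //.
have m1 : 0 < m%:R :> R by rewrite ltr0n.
have c0 := expR_ge0 (mu / k%:R).
rewrite -mulrA expRM_natl ler_pXn2r ?nnegrE ?expR_ge0 //; last first.
  by rewrite divr_ge0 ?ler0n // addr_ge0 // subr_ge0 ler1n.
apply: le_trans (expR_ge1Dx _); rewrite ler_pdivrMr // mulrDl divfK ?gt_eqF //.
lra.
Qed.

(** * Two consecutive sizes *)

(** In use k is [floor x], so h is [k.+1]: the union bound excludes sizes up to h - 1, and the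
    second moment provides a hitting set of size h + 1. Only whether size h is attained stays
    open. *)
Lemma min_hitting_size_eq_or {n} (F : {set {set 'I_n}}) (k : nat) :
  ~~ [exists S : {set 'I_n}, (#|S| <= k)%N && hitting_set F S] ->
  [exists S : {set 'I_n}, (#|S| == k.+2) && hitting_set F S] ->
  min_hitting_size_eq F k.+1%:Z || min_hitting_size_eq F (k.+1%:Z + 1).
Proof.
rewrite negb_exists => /forallP small /existsP[S /andP[/eqP Sk hS]].
have [/existsP[T /andP[/eqP Tk hT]]|noT] :=
    boolP [exists T : {set 'I_n}, (#|T| == k.+1) && hitting_set F T].
  apply/orP; left; apply/andP; split.
    by apply/existsP; exists T; rewrite hT Tk eqxx.
  apply/forallP => U; apply/implyP; rewrite ltz_nat ltnS => Uk.
  by have := small U; rewrite Uk.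
apply/orP; right; apply/andP; split.
  by apply/existsP; exists S; rewrite hS Sk -addn1 PoszD eqxx.
apply/forallP => U; apply/implyP; rewrite -PoszD addn1 ltz_nat ltnS leq_eqVlt => /orP[Uk|].
  by move: noT; rewrite negb_exists => /forallP/(_ U); rewrite Uk.
by rewrite ltnS => Uk; have := small U; rewrite Uk.
Qed.

Lemma random_set_system_prob_min_hitting_size {R : realType} {n} (p : R) (k m : nat)
    (mu := - ln (1 - p) * 2 ^+ (n - k.+2)) :
  0 <= p < 1 -> (0 < n)%N -> (0 < m)%N -> (k.+2 * m <= n)%N ->
  1 - (n%:R ^+ k * (1 - p) ^+ (2 ^ (n - k)) +
       (expR (mu / 2 ^+ k.+2 + k.+2%:R * expR (mu / k.+2%:R) / m%:R) - 1)) <=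
  random_set_system_prob p (fun F : {set {set 'I_n}} =>
    min_hitting_size_eq F k.+1%:Z || min_hitting_size_eq F (k.+1%:Z + 1)).
Proof.
move=> p01 n0 m0 kmn; have p01' : 0 <= p <= 1 by case/andP: p01 => -> /ltW.
rewrite random_set_system_prob_compl lerD2l lerN2.
have small := @random_set_system_prob_hitting_small R n p k p01' n0.
have large := @random_set_system_prob_no_hitting R n p k.+2 m p01 isT m0 kmn.
apply: le_trans (lerD small large); clear small large.
pose P (b : bool) : pred {set {set 'I_n}} :=
  if b then [pred F | [exists S : {set 'I_n}, (#|S| <= k)%N && hitting_set F S]]
  else [pred F | ~~ [exists S : {set 'I_n}, (#|S| == k.+2) && hitting_set F S]].
have := @random_set_system_prob_union R n p bool _ P p01'.
rewrite big_bool; apply=> F /= nE; apply/existsP.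
case small: [exists S : {set 'I_n}, (#|S| <= k)%N && hitting_set F S]; first by exists true.
exists false => /=; apply: contra nE; apply: min_hitting_size_eq_or.
by rewrite small.
Qed.

(** * Explicit error bounds *)

Lemma pow2_expR {R : realType} (j : nat) : 2 ^+ j = expR (j%:R * ln 2) :> R.
Proof. by rewrite expRM_natl lnK // posrE. Qed.

(** In use [u = alpha * ln n] and [L = alpha * lg n * ln n]. The bound on [k] says that
    [p * 2 ^+ (n - k) >= L], and [1 - p <= expR (- p)] then bounds the second factor by
    [expR (- L)]. *)
Lemma first_moment_estimate {R : realType} (n k : nat) (p u L : R) :
  0 <= p <= 1 -> (0 < n)%N -> (k <= n)%N -> 0 < L ->
  p * 2 ^+ n = expR u -> k%:R * ln 2 <= u - ln L ->
  n%:R ^+ k * (1 - p) ^+ (2 ^ (n - k)) <= expR (k%:R * ln n%:R - L).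
Proof.
move=> /andP[p0 p1] n0 kn L0 pn kL.
have nE : n%:R ^+ k = expR (k%:R * ln n%:R) :> R.
  by rewrite expRM_natl lnK // posrE ltr0n.
rewrite nE expRD ler_wpM2l ?expR_ge0 //.
apply: (@le_trans _ _ (expR (- p) ^+ (2 ^ (n - k)))).
  by rewrite ler_pXn2r ?nnegrE ?expR_ge0 ?subr_ge0 ?expn_gt0 // expR_ge1Dx.
rewrite -expRM_natl ler_expR mulrN lerN2 mulrC natrX.
have -> : p * 2 ^+ (n - k) = expR (u - k%:R * ln 2).
  rewrite expRB -pn -pow2_expR -mulrA; congr (_ * _).
  by rewrite -{2}(subnK kn) exprD mulfK // expf_neq0 // pnatr_eq0.
by rewrite -ler_ln ?posrE ?expR_gt0 // expRK; lra.
Qed.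

(** The extra [ln 2] in the lower bound on [k] gives [p * 2 ^+ (n - k) <= L / 2]. This halving keeps
    [mu / k] at most [3 / 4 * t], so [expR (mu / k) / n] is at most [expR (- (t / 4))]; with
    [mu / k] near [t] there would be no decay. *)
Lemma second_moment_estimate {R : realType} (n k m : nat) (p u L b : R)
    (t := ln n%:R) (mu := - ln (1 - p) * 2 ^+ (n - k)) :
  0 <= p <= 1 / 10 -> (0 < k <= n)%N -> (0 < m)%N -> (n <= 2 * (k * m))%N -> 0 < L ->
  p * 2 ^+ n = expR u -> u - ln L + ln 2 <= k%:R * ln 2 ->
  L = b * t ^+ 2 -> 0 < t -> 0 < b -> 9 / 10 * (b * t) <= k%:R <= b * t ->
  mu / 2 ^+ k + k%:R * expR (mu / k%:R) / m%:R <=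
  L ^+ 2 * expR (- u) + 2 * (b * t) ^+ 2 * expR (- (4^-1 * t)).
Proof.
move=> /andP[p0 p1] /andP[k0 kn] m0 nkm L0 pn kL LE t0 b0 /andP[bk kb].
have n0 : (0 < n)%N := leq_trans k0 kn.
have kR : 0 < k%:R :> R by rewrite ltr0n.
have mR : 0 < m%:R :> R by rewrite ltr0n.
have k2 : 0 < 2 ^+ k :> R by rewrite exprn_gt0.
have bt0 : 0 < b * t by rewrite mulr_gt0.
have inv2k : 1 / 2 ^+ k <= L * expR (- u) / 2.
  rewrite pow2_expR div1r -expRN.
  have -> : L * expR (- u) / 2 = expR (ln L - u - ln 2).
    by rewrite !expRD !expRN !lnK ?posrE // addrC.
  by rewrite ler_expR; lra.
have M0 : 0 < 2 ^+ (n - k) :> R by rewrite exprn_gt0.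
(* The factor is 10/9 times 1/2: [- ln (1 - p) = ln (1 + p / (1 - p)) <= p / (1 - p)], which is at
   most [10 / 9 * p] for [p <= 1 / 10]. *)
have muL : mu <= 5 / 9 * L.
  have lnp : - ln (1 - p) <= 10 / 9 * p.
    have q0 : 0 < 1 - p by lra.
    rewrite -lnV ?posrE //.
    have -> : (1 - p)^-1 = 1 + p / (1 - p) by field; rewrite gt_eqF.
    apply: le_trans (le_ln1Dx _) _.
      by rewrite (lt_le_trans _ (divr_ge0 p0 (ltW q0))) // ltrN10.
    by rewrite ler_pdivrMr //; nra.
  have pM : p * 2 ^+ (n - k) = expR u * (1 / 2 ^+ k).
    rewrite -pn -mulrA; congr (_ * _).
    by rewrite -{2}(subnK kn) exprD mul1r mulfK // gt_eqF.
  have eL : expR u * (1 / 2 ^+ k) <= L / 2.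
    apply: le_trans (ler_wpM2l (expR_ge0 u) inv2k) _.
    by rewrite mulrA (mulrC L) mulrA expRxMexpNx_1 mul1r.
  have := ler_wpM2r (ltW M0) lnp; rewrite -/mu -(mulrA _ p) pM; lra.
have mu1 : mu / 2 ^+ k <= L ^+ 2 * expR (- u).
  have i0 : 0 <= 1 / 2 ^+ k :> R by rewrite divr_ge0 // ltW.
  have := expR_gt0 (- u) => e0.
  rewrite -[mu]mulr1 -mulrA.
  apply: le_trans (ler_wpM2r i0 muL) _.
  apply: le_trans (ler_wpM2l _ inv2k) _; first by lra.
  have := mulr_gt0 (mulr_gt0 L0 L0) e0; rewrite expr2; lra.
(* Dividing the 5/9 of [muL] by the 9/10 of [bk] gives 50/81, below 3/4. *)
have muk : mu / k%:R <= 3 / 4 * t.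
  rewrite ler_pdivrMr //; apply: le_trans muL _.
  have := ler_wpM2l (ltW t0) bk; have := mulr_gt0 bt0 t0; rewrite LE expr2; lra.
apply: lerD mu1 _.
have nE : n%:R = expR t :> R by rewrite lnK // posrE ltr0n.
have minv : (m%:R)^-1 <= 2 * k%:R / n%:R :> R.
  by rewrite -div1r ler_pdivrMr // mulrAC ler_pdivlMr ?ltr0n // mul1r -!natrM ler_nat -mulnA.
have -> : expR (- (4^-1 * t)) = expR (3 / 4 * t) / n%:R.
  by rewrite nE -expRN -expRD; congr expR; lra.
apply: (@le_trans _ _ (k%:R * expR (3 / 4 * t) * (2 * k%:R / n%:R))).
  apply: ler_pM => //; rewrite ?invr_ge0 ?ler0n ?mulr_ge0 ?expR_ge0 ?ler0n //.
  by rewrite ler_pM2l // ler_expR.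
have -> : k%:R * expR (3 / 4 * t) * (2 * k%:R / n%:R) =
  2 * k%:R ^+ 2 * (expR (3 / 4 * t) / n%:R) :> R by ring.
rewrite ler_wpM2r ?divr_ge0 ?expR_ge0 ?ler0n //.
by rewrite ler_pM2l // ler_pXn2r // nnegrE ltW.
Qed.

Lemma two_point_estimate {R : realType} (alpha : R) (n : nat)
    (t := ln n%:R) (b := alpha / ln 2) (L := b * t ^+ 2) (p := inclusion_prob alpha n) :
  0 < alpha -> 1 < t -> 4 <= L -> ln L <= alpha * t / 10 -> b * t <= n%:R -> p <= 1 / 10 ->
  1 - (expR (- t) +
       (expR (L ^+ 2 * expR (- (alpha * t)) + 2 * (b * t) ^+ 2 * expR (- (4^-1 * t))) - 1)) <=
  random_set_system_prob p (fun F : {set {set 'I_n}} =>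
    min_hitting_size_eq F (hitting_threshold alpha (fun=> 0) n)
    || min_hitting_size_eq F (hitting_threshold alpha (fun=> 0) n + 1)).
Proof.
move=> a0 t1 L4 lnL btn p1.
have ln2 : 0 < ln 2 :> R by rewrite ln_gt0 // ltr1n.
have b0 : 0 < b by rewrite divr_gt0.
have t0 : 0 < t by lra.
have L0 : 0 < L by lra.
(* [ln 0] is 0 by convention, so [t > 0] excludes [n = 0]. *)
have n0 : (0 < n)%N.
  by move: t0; rewrite /t; case: (n) => // ; rewrite ln0 ?ltxx.
have abt : alpha * t = b * t * ln 2 by rewrite /b; field; rewrite gt_eqF.
have ln4 : 2 * ln 2 <= ln L.
  rewrite mulr_natl -lnXn // ler_ln ?posrE ?exprn_gt0 //.
  by apply: le_trans L4; lra.
pose x := b * t - ln L / ln 2.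
have xE : hitting_threshold alpha (fun=> 0) n = Num.floor x + 1.
  rewrite /hitting_threshold /lg subr0 -/t; congr (Num.floor (_ - ln _ / _) + 1).
    by rewrite /b; ring.
  by rewrite /L /b; ring.
(* Together with [lnL2] this places [x] between [9 / 10 * (b * t)] and [b * t - 2]. The gap of 2
   gives [k.+2 <= b * t <= n] and makes the first moment exponent [k * t - L] at most [- 2 * t]. *)
have lnLb : ln L / ln 2 <= b * t / 10 by rewrite ler_pdivrMr //; lra.
have bt20 : 20 <= b * t by rewrite -(ler_pM2r ln2); lra.
have lnL2 : 2 <= ln L / ln 2 by rewrite ler_pdivlMr.
have [k kE] : exists k : nat, Num.floor x = k%:Z.
  have : 0 <= Num.floor x by rewrite floor_ge_int /x; lra.
  by case: (Num.floor x) => // k _; exists k.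
have /andP[kx xk] := floor_itv x.
rewrite {}kE -[k%:~R]/(k%:R : R) in xE kx xk.
have {}xk : x + 1 < k.+2%:R.
  by move: xk; rewrite intrD -[k%:~R]/(k%:R : R) -[in k.+2]addn2 natrD; lra.
have k2x : k.+2%:R <= x + 2 by rewrite -[in k.+2]addn2 natrD; lra.
have k2n : (k.+2 <= n)%N by rewrite -(ler_nat R); rewrite /x in k2x; lra.
have xln : x * ln 2 = alpha * t - ln L by rewrite mulrBl divfK ?gt_eqF // abt.
have pE : p * 2 ^+ n = expR (alpha * t).
  by rewrite /p /inclusion_prob divfK ?expf_neq0 ?pnatr_eq0 // /powR pnatr_eq0 gtn_eqF.
have p0 : 0 <= p by rewrite divr_ge0 ?powR_ge0 ?exprn_ge0.
pose m := (n %/ k.+2)%N.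
have m0 : (0 < m)%N by rewrite divn_gt0.
have km : (k.+2 * m <= n)%N by rewrite mulnC leq_trunc_div.
(* The remainder of [n] is below [k.+2], hence at most [k.+2 * m] since [m > 0]. *)
have n2km : (n <= 2 * (k.+2 * m))%N.
  rewrite mul2n -addnn {1}(divn_eq n k.+2) mulnC leq_add2l.
  by rewrite (leq_trans (ltnW (ltn_pmod n _))) // leq_pmulr.
have -> : hitting_threshold alpha (fun=> 0) n = k.+1%:Z by rewrite xE -addn1 PoszD.
apply: le_trans _ (@random_set_system_prob_min_hitting_size R n p k m _ n0 m0 km); last first.
  by rewrite p0 /=; lra.
rewrite lerD2l lerN2; apply: lerD.
  apply: le_trans (@first_moment_estimate R n k p (alpha * t) L _ n0 _ L0 pE _) _.
  - by rewrite p0 /=; lra.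
  - by rewrite (leq_trans _ k2n) // ltnW.
  - by rewrite -xln ler_pM2r.
  rewrite ler_expR -/t.
  have LE : L = b * t * t by rewrite /L expr2 mulrA.
  have := ler_wpM2r (ltW t0) kx; have := ler_wpM2r (ltW t0) lnL2.
  by rewrite /x mulrBl LE; lra.
rewrite lerD2r ler_expR; apply: second_moment_estimate => //.
- by rewrite p0.
- by rewrite -xln; have := ltW xk; rewrite -(ler_pM2r ln2); lra.
- by rewrite -/t /x in xk k2x *; apply/andP; split; lra.
Qed.

(** * Limits as n tends to infinity *)

Local Open Scope classical_set_scope.
Local Open Scope ring_scope.

Lemma cvg_expr_expRN {R : realType} (c : R) (j : nat) : 0 < c ->
  t ^+ j * expR (- (c * t)) @[t --> +oo] --> (0 : R).
Proof.
(* [C] comes from the term of degree [j + 1] in the exponential series: one power more than [j]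
   leaves the bound [C / t]. *)
move=> c0; pose C : R := (j.+1)`!%:R / c ^+ j.+1.
have C0 : 0 < C by rewrite divr_gt0 ?exprn_gt0 // ltr0n fact_gt0.
apply: (@squeeze_cvgr _ _ _ _ (fun=> 0) (fun t => C * t^-1)).
- near=> t; have t0 : 0 < t by near: t; exact: nbhs_pinfty_gt.
  have t0' := ltW t0; rewrite mulr_ge0 ?exprn_ge0 ?expR_ge0 //= expRN.
  rewrite ler_pdivrMr ?expR_gt0 // mulrAC ler_pdivlMr // -exprSr.
  rewrite -ler_pdivrMl // /C invf_div mulrC mulrA -exprMn (mulrC t).
  apply: le_trans _ (@expR_ge1Dxn R (c * t) j _); last by rewrite mulr_ge0 // ltW.
  by rewrite lerDr.
- exact: cvg_cst.
- rewrite -(mulr0 C); apply: cvgMr.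
  apply/gtr0_cvgV0; last exact: cvg_id.
  exact: nbhs_pinfty_gt.
Unshelve. all: by end_near. Qed.

Lemma cvgr_ln {R : realType} : ln (n%:R : R) @[n --> \oo] --> +oo.
Proof.
apply/cvgryPge => A; have /cvgryPge /(_ (expR A)) := @cvgr_idn R.
apply: filterS => n An.
by rewrite -ler_expR lnK // posrE (lt_le_trans (expR_gt0 A)).
Qed.

Lemma near_expr_le_expR {R : realType} (C c : R) (j : nat) : 0 < c ->
  \forall t \near +oo, C * t ^+ j <= expR (c * t).
Proof.
move=> c0; have : C * (t ^+ j * expR (- (c * t))) @[t --> +oo] --> C * 0.
  by apply: cvgMr; exact: cvg_expr_expRN.
rewrite mulr0 => /(@cvgr_le _ _ _ _ _ 0) /(_ 1 ltr01); apply: filterS => t.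
by rewrite mulrA expRN ler_pdivrMr ?expR_gt0 // mul1r.
Qed.

Lemma near_estimate_conditions {R : realType} (alpha : R) (b := alpha / ln 2) :
  0 < alpha ->
  \forall n \near \oo,
    [/\ 1 < ln n%:R :> R, 4 <= b * ln n%:R ^+ 2,
      ln (b * ln n%:R ^+ 2) <= alpha * ln n%:R / 10,
      b * ln n%:R <= n%:R & inclusion_prob alpha n <= 1 / 10].
Proof.
move=> a0.
have ln2 : 0 < ln 2 :> R by rewrite ln_gt0 // ltr1n.
have b0 : 0 < b by rewrite divr_gt0.
have a10 : 0 < alpha / 10 by rewrite divr_gt0.
near=> n.
have n0 : (0 < n)%N by near: n; exact: nbhs_infty_gt.
(* With 9, [expR t >= 1 + t >= 10] bounds the inclusion probability at the end; [4 / b] below gives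
   [b * t ^+ 2 >= 4] because [t >= 1]. *)
have t9 : 9 <= ln n%:R :> R by near: n; move/cvgryPge : (@cvgr_ln R); apply.
have t4 : 4 / b <= ln n%:R by near: n; move/cvgryPge : (@cvgr_ln R); apply.
have et2 : b * ln n%:R ^+ 2 <= expR (alpha / 10 * ln n%:R).
  by near: n; exact: (@cvgr_ln R _ (@near_expr_le_expR R b (alpha / 10) 2 a10)).
have etb : b * ln n%:R ^+ 1 <= expR (1 * ln n%:R).
  by near: n; exact: (@cvgr_ln R _ (@near_expr_le_expR R b 1 1 ltr01)).
(* This amounts to [(alpha + 1) * t <= n * ln 2], so the inclusion probability is at most
   [expR (- t)]. *)
have eta : (alpha + 1) / ln 2 * ln n%:R ^+ 1 <= expR (1 * ln n%:R).
  by near: n; exact: (@cvgr_ln R _ (@near_expr_le_expR R ((alpha + 1) / ln 2) 1 1 ltr01)).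
have nE : n%:R = expR (ln n%:R) :> R by rewrite lnK // posrE ltr0n.
move: nE t9 t4 et2 etb eta.
move: (ln n%:R) => t nE t9 t4 et2 etb eta.
have L4 : 4 <= b * t ^+ 2.
  move: t4; rewrite ler_pdivrMr // mulrC => /le_trans; apply; rewrite ler_pM2l //.
  by rewrite expr2 ler_peMl //; lra.
split=> //.
- by lra.
- rewrite -ler_expR lnK ?posrE; last by lra.
  by rewrite [alpha * t / 10]mulrAC.
- by move: etb; rewrite expr1 mul1r -nE.
- move: eta; rewrite expr1 mul1r mulrAC ler_pdivrMr // => at2.
  have -> : inclusion_prob alpha n = expR (alpha * t - expR t * ln 2).
    by rewrite /inclusion_prob /powR pnatr_eq0 gtn_eqF // pow2_expR -expRB nE expRK.
  apply: (@le_trans _ _ (expR (- t))); first by rewrite ler_expR; lra.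
  rewrite expRN -div1r ler_pdivrMr ?expR_gt0 //; have := expR_ge1Dx t; lra.
Unshelve. all: by end_near. Qed.

Theorem theorem4 (R : realType) (alpha : R) (alpha_gt0 : 0 < alpha) :
  exists o : nat -> R,
    (o n @[n --> \oo] --> (0 : R)) /\
    (random_set_system_prob (inclusion_prob alpha n)
       (fun F : {set {set 'I_n}} =>
          min_hitting_size_eq F (hitting_threshold alpha o n)
          || min_hitting_size_eq F (hitting_threshold alpha o n + 1))
       @[n --> \oo] --> (1 : R)).
Proof.
exists (fun=> 0); split; first exact: cvg_cst.
pose b := alpha / ln 2.
(* The error of [two_point_estimate] as a function of [t = ln n] alone; its limit at infinity is
   composed with [cvgr_ln]. *)
pose err (t : R) := expR (- t) +
  (expR ((b * t ^+ 2) ^+ 2 * expR (- (alpha * t)) +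
         2 * (b * t) ^+ 2 * expR (- (4^-1 * t))) - 1).
have err0 : err t @[t --> +oo] --> (0 : R).
  have expo0 : (b * t ^+ 2) ^+ 2 * expR (- (alpha * t)) +
      2 * (b * t) ^+ 2 * expR (- (4^-1 * t)) @[t --> +oo] --> (0 : R).
    have -> : (fun t => (b * t ^+ 2) ^+ 2 * expR (- (alpha * t)) +
        2 * (b * t) ^+ 2 * expR (- (4^-1 * t))) =
      (fun t => b ^+ 2 * (t ^+ 4 * expR (- (alpha * t))) +
        2 * b ^+ 2 * (t ^+ 2 * expR (- (4^-1 * t)))).
      by apply/funext => t; ring.
    rewrite -[0 in X in _ --> X](addr0 (0 : R)); apply: cvgD.
      by rewrite -[0 in X in _ --> X](mulr0 (b ^+ 2)); apply: cvgMr; exact: cvg_expr_expRN.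
    rewrite -[0 in X in _ --> X](mulr0 (2 * b ^+ 2)); apply: cvgMr.
    by apply: cvg_expr_expRN; rewrite invr_gt0.
  have -> : (0 : R) = 0 + (expR 0 - 1) by rewrite expR0 subrr addr0.
  apply: cvgD; first exact: cvgr_expR.
  apply: cvgB; last exact: cvg_cst.
  exact: cvg_comp expo0 (@continuous_expR R 0).
apply: (@squeeze_cvgr _ _ _ _ (fun n => 1 - err (ln n%:R)) (fun=> 1)).
- apply: filterS (@near_estimate_conditions R alpha alpha_gt0) => n [t1 L4 lnL btn p1].
  rewrite two_point_estimate //=.
  apply: random_set_system_prob_le1.
  rewrite divr_ge0 ?powR_ge0 ?exprn_ge0 //=.
  by apply: le_trans p1 _; lra.
- rewrite -[1 in X in _ --> X](subr0 (1 : R)); apply: cvgB; first exact: cvg_cst.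
  exact: cvg_comp cvgr_ln err0.
- exact: cvg_cst.
Qed.
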